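(* Let $X,Y$ be real Hausdorff locally convex topological vector spaces, let $\varphi: X\times Y\to\overline{\mathbb R}$ be a proper generalized polyhedral convex function and $G: X\rightrightarrows Y$ a generalized polyhedral convex set-valued map. Let $\mu(x)=\inf\{\varphi(x,y)\mid y\in G(x)\}$ and $M(x)=\{y\in G(x)\mid \mu(x)=\varphi(x,y)\}$ for $x\in X$. Then for any $\bar x\in X$ with $\mu(\bar x)\in\mathbb R$, and for any $\bar y\in M(\bar x)$, one has $$\partial\mu(\bar x)=\mathrm{pr}_{X^*}\Big[\overline{\partial\varphi(\bar x,\bar y)+N((\bar x,\bar y);\mathrm{gph}\,G)}\cap\big(X^*\times\{0\}\big)\Big]$$ and $$\partial^\infty\mu(\bar x)=\mathrm{pr}_{X^*}\Big[\overline{\partial^\infty\varphi(\bar x,\bar y)+N((\bar x,\bar y);\mathrm{gph}\,G)}\cap\big(X^*\times\{0\}\big)\Big].$$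
   Context: $\overline{\mathbb R}=\mathbb R\cup\{\pm\infty\}$, $\inf\emptyset=+\infty$. Dual spaces $X^*$, $Y^*$ carry the weak$^*$ topology, $(X\times Y)^*$ is identified with $X^*\times Y^*$, and an overline over a subset of a dual space is the weak$^*$ closure. $\mathrm{pr}_{X^*}:X^*\times Y^*\to X^*$, $(x^*,y^* )\mapsto x^*$. A function $f:Z\to\overline{\mathbb R}$ is proper if $\mathrm{dom}\,f=\{z\mid f(z)<+\infty\}\ne\emptyset$ and $f(z)\neq-\infty$ for all $z$; $\mathrm{epi}\,f=\{(z,\lambda)\in Z\times\mathbb R\mid f(z)\le\lambda\}$; $f$ is convex if $\mathrm{epi}\,f$ is convex. For a set-valued map, $\mathrm{gph}\,G=\{(x,y)\mid y\in G(x)\}$. A subset $D$ of a real Hausdorff locally convex space $Z$ is a generalized polyhedral convex set if $D=\{z\in L\mid \langle z_i^*,z\rangle\le\alpha_i,\ i=1,\dots,p\}$ for some $z_i^*\in Z^*$, $\alpha_i\in\mathbb R$, and some closed affine subspace $L\subset Z$. A function (resp. set-valued map) is generalized polyhedral convex if its epigraph (resp. its graph) is a generalized polyhedral convex set. Normal cone to a convex set $C$: $N(\bar z;C)=\{z^*\mid\langle z^*,z-\bar z\rangle\le0\ \forall z\in C\}$ if $\bar z\in C$, and $\emptyset$ otherwise. For convex $f$ with $f(\bar z)\in\mathbb R$: $\partial f(\bar z)=\{z^*\mid\langle z^*,z-\bar z\rangle\le f(z)-f(\bar z)\ \forall z\in Z\}$ and $\partial^\infty f(\bar z)=\{z^*\mid(z^*,0)\in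 N((\bar z,f(\bar z));\mathrm{epi}\,f)\}$; both are $\emptyset$ if $f(\bar z)\notin\mathbb R$. Under the stated assumptions $\mu$ is a convex function. *)

(* Defs.v *)
From HB Require Import structures.
From mathcomp Require Import all_boot all_order all_algebra.
From mathcomp Require Import all_classical all_reals all_analysis.

Set Implicit Arguments.
Unset Strict Implicit.
Unset Printing Implicit Defensive.

Import Order.TTheory GRing.Theory Num.Theory.
Import numFieldNormedType.Exports.

Local Open Scope classical_set_scope.
Local Open Scope ring_scope.

Section dual_space.
Context {R : realType} (E : tvsType R).

Definition dual_pred (f : E -> R^o) : bool := `[< scalar f /\ continuous f >].

Record dual := Dual { dual_fun :> E -> R^o; _ : dual_pred dual_fun }.

HB.instance Definition _ := [isSub for dual_fun].
HB.instance Definition _ := [Choice of dual by <:].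

Lemma dual_subsemimod_closed : subsemimod_closed dual_pred.
Proof.
split; [split|].
- apply/asboolP; split; first by move=> a u v; rewrite /= mulr0 addr0.
  by move=> x; exact: cvg_cst.
- move=> f g /asboolP[fl fc] /asboolP[gl gc]; apply/asboolP; split.
    by move=> a u v; rewrite !fctE fl gl mulrDr addrACA.
  by move=> x; apply: (@cvgD _ R^o); [exact: fc|exact: gc].
- move=> b f /asboolP[fl fc]; apply/asboolP; split.
    by move=> a u v; rewrite !fctE fl scalerDr; congr (_ + _); exact: mulrCA.
  by move=> x; apply: (@cvgZr _ R^o); exact: fc.
Qed.

HB.instance Definition _ :=
  GRing.isSubmodClosed.Build R (E -> R^o) dual_pred dual_subsemimod_closed.
HB.instance Definition _ := [SubChoice_isSubLmodule of dual by <:].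

(* The weak* topology: the topology induced by that of pointwise convergence. *)
HB.instance Definition _ := Topological.copy dual
  (initial_topology (dual_fun : dual -> {ptws E -> R^o})).

Lemma dual_scalar (f : dual) : scalar f.
Proof. by have /asboolP[] := valP f. Qed.

Lemma dual_continuous (f : dual) : continuous f.
Proof. by have /asboolP[] := valP f. Qed.

End dual_space.

Section dual_product.
Context {R : realType} {E F : tvsType R}.

Lemma dual_pair_subproof (p : dual E * dual F) :
  dual_pred (fun z : E * F => (p.1 z.1 + p.2 z.2 : R^o)).
Proof.
apply/asboolP; split.
  by move=> a u v /=; rewrite !dual_scalar mulrDr addrACA.
move=> z; apply: (@cvgD _ R^o).
  by apply: (@cvg_comp _ _ _ fst p.1); [exact: cvg_fst|exact: dual_continuous].
by apply: (@cvg_comp _ _ _ snd p.2); [exact: cvg_snd|exact: dual_continuous].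
Qed.

(* The identification of E^* x F^* with (E x F)^*. *)
Definition dual_pair (p : dual E * dual F) : dual (E * F)%type :=
  Dual (dual_pair_subproof p).

Lemma dual_fst_subproof (h : dual (E * F)%type) :
  dual_pred (fun x : E => h (x, 0)).
Proof.
apply/asboolP; split.
  move=> a u v; rewrite -(dual_scalar h a (u, 0) (v, 0)).
  by congr (h _); congr pair; rewrite /= scaler0 addr0.
move=> x; apply: (@continuous_comp E _ R^o (fun x : E => (x, 0 : F)) h).
  by apply: cvg_pair => /=; [exact: cvg_id|exact: cvg_cst].
exact: dual_continuous.
Qed.

Lemma dual_snd_subproof (h : dual (E * F)%type) :
  dual_pred (fun y : F => h (0, y)).
Proof.
apply/asboolP; split.
  move=> a u v; rewrite -(dual_scalar h a (0, u) (0, v)).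
  by congr (h _); congr pair; rewrite /= scaler0 addr0.
move=> x; apply: (@continuous_comp F _ R^o (fun y : F => (0 : E, y)) h).
  by apply: cvg_pair => /=; [exact: cvg_cst|exact: cvg_id].
exact: dual_continuous.
Qed.

Lemma dual_pair_bij : bijective dual_pair.
Proof.
have dual0 (V : tvsType R) (f : dual V) : f 0 = 0 :> R.
  by have := dual_scalar f (-1) 0 0; rewrite scaler0 addr0 mulN1r addNr.
exists (fun h => (Dual (dual_fst_subproof h), Dual (dual_snd_subproof h))).
  move=> [f g]; congr pair; apply/val_inj/funext => x /=.
    by rewrite dual0 addr0.
  by rewrite dual0 add0r.
move=> h; apply/val_inj/funext => -[x y] /=.
rewrite -[h (x, 0)]mul1r -(dual_scalar h).
by congr (h _); congr pair; rewrite /= scale1r ?addr0 ?add0r.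
Qed.

End dual_product.

Section generalized_polyhedral.
Context {R : realType}.

Definition affine_subspace (E : tvsType R) (L : set E) : Prop :=
  exists (a : E) (V : set E), submod_closed (mem V) /\ L = [set a + v | v in V].

Definition gpoly_convex_set (E : tvsType R) (D : set E) : Prop :=
  exists (L : set E) (p : nat) (zs : 'I_p -> dual E) (alpha : 'I_p -> R),
    [/\ affine_subspace L, closed L &
        D = [set z | L z /\ forall i, zs i z <= alpha i]].

Definition edom (E : Type) (f : E -> \bar R) : set E := [set z | (f z < +oo)%E].

Definition proper_fun (E : Type) (f : E -> \bar R) : Prop :=
  edom f !=set0 /\ forall z, f z <> -oo%E.

Definition epi (E : Type) (f : E -> \bar R) : set (E * R^o) :=
  [set p | (f p.1 <= (p.2 : R)%:E)%E].

Definition gph (E F : Type) (G : E -> set F) : set (E * F) :=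
  [set p | G p.1 p.2].

Definition gpoly_convex_fun (E : tvsType R) (f : E -> \bar R) : Prop :=
  gpoly_convex_set (epi f).

Definition gpoly_convex_map (E F : tvsType R) (G : E -> set F) : Prop :=
  gpoly_convex_set (gph G).

End generalized_polyhedral.

Section subdifferentials.
Context {R : realType}.

Definition normal_cone (E : tvsType R) (z : E) (C : set E) : set (dual E) :=
  [set zs | C z /\ forall w, C w -> zs (w - z) <= 0].

Definition subdiff (E : tvsType R) (f : E -> \bar R) (z : E) : set (dual E) :=
  [set zs | f z \is a fin_num /\
            forall w, ((zs (w - z))%:E <= f w - f z)%E].

Definition singular_subdiff (E : tvsType R) (f : E -> \bar R) (z : E) :
    set (dual E) :=
  [set zs | f z \is a fin_num /\
            normal_cone (z, fine (f z) : R^o) (epi f) (dual_pair (zs, 0))].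

End subdifferentials.

Definition dual_add {R : realType} (E : tvsType R) (A B : set (dual E)) :
    set (dual E) :=
  [set a + b | a in A & b in B].

(* pr_{E^*} [W `&` (E^* x {0})] for W included in (E x F)^*, seen as E^* x F^*. *)
Definition pr_dual0 {R : realType} (E F : tvsType R)
    (W : set (dual (E * F)%type)) : set (dual E) :=
  fst @` ((dual_pair @^-1` W) `&` (setT `*` [set 0 : dual F])).

Section optimal_value.
Context {R : realType} (X Y : tvsType R).

Definition opt_value (phi : X * Y -> \bar R) (G : X -> set Y) (x : X) : \bar R :=
  ereal_inf [set phi (x, y) | y in G x].

Definition solution_map (phi : X * Y -> \bar R) (G : X -> set Y) (x : X) :
    set Y :=
  [set y | G x y /\ opt_value phi G x = phi (x, y)].

End optimal_value.

(* Main.v *)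
(* Let z = (x, y), r = phi z, D = gph G, and let k be a scalar, -1 for the
   subdifferential and 0 for the singular one. Then x* lies in the left-hand
   side iff ((x*, 0), k) is normal at (z, r) to epi phi `&` (D x R), an
   intersection of two generalized polyhedral sets. Its normals are, on the
   common direction space V1 `&` V2, nonnegative combinations of the active
   constraints, by Farkas; so everything reduces to (V1 `&` V2)^o being the
   weak* closure of V1^o + V2^o. On finitely many vectors an element of
   (V1 `&` V2)^o even coincides with an element of V1^o + V2^o: by Hahn-Banach
   the closed subspaces V1 and V2 are the annihilators of V1^o and V2^o, so that
   V1^o + V2^o has annihilator V1 `&` V2, and this is all that finite
   interpolation requires. Such agreement on finite sets is stronger than weak*
   approximation and keeps the component k exact. *)
Require Import Defs.
From mathcomp Require Import all_boot all_order all_algebra.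
From mathcomp Require Import all_classical all_reals all_analysis.
From mathcomp Require Import ring lra.

Set Implicit Arguments.
Unset Strict Implicit.
Unset Printing Implicit Defensive.

Import Order.TTheory GRing.Theory Num.Theory.
Import numFieldNormedType.Exports.

Local Open Scope classical_set_scope.
Local Open Scope ring_scope.

(** * The Hahn-Banach theorem for sublinear functionals *)

Section hahn_banach.
Context {R : realType} {E : lmodType R}.
Implicit Types (p q : E -> R) (x y : E).

Definition sublinear p : Prop :=
  (forall x y, p (x + y) <= p x + p y) /\
  (forall (s : R) x, 0 <= s -> p (s *: x) <= s * p x).

Lemma sublinear0 p : sublinear p -> p 0 = 0.
Proof.
move=> [pD pZ]; apply/eqP; rewrite eq_le; apply/andP; split.
  by have := pZ 0 0 (lexx 0); rewrite scale0r mul0r.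
by have := pD 0 0; rewrite addr0; lra.
Qed.

Lemma sublinearZ p (s : R) x : sublinear p -> 0 <= s -> p (s *: x) = s * p x.
Proof.
move=> ps; have [_ pZ] := ps; rewrite le_eqVlt => /predU1P[<-|s0].
  by rewrite scale0r mul0r sublinear0.
apply/eqP; rewrite eq_le pZ ?(ltW s0)//= -ler_pdivlMl//.
by have := pZ s^-1 (s *: x); rewrite scalerA mulVf ?gt_eqF// scale1r;
  apply; rewrite invr_ge0 ltW.
Qed.

Lemma sublinear_geN p x : sublinear p -> - p (- x) <= p x.
Proof.
by move=> ps; have [pD _] := ps; have := pD x (- x); rewrite subrr sublinear0//; lra.
Qed.

(** At [- y], taking [t = 1] gives at most [- p y] for sublinear [p], so a linear functional below
    [tilt p y] is at least [p y] at [y]. *)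
Definition tilt p y x : R :=
  inf [set p (x + t *: y) - t * p y | t in [set t : R | 0 <= t]].

Lemma tilt_le p y x (t : R) : sublinear p -> 0 <= t ->
  tilt p y x <= p (x + t *: y) - t * p y.
Proof.
move=> ps t0; have [pD _] := ps; apply: ge_inf; last by exists t.
exists (- p (- x)) => _ [s /= s0 <-]; rewrite -sublinearZ//.
by have := pD (x + s *: y) (- x); rewrite addrAC subrr add0r; lra.
Qed.

Lemma le_tilt p y x (c : R) :
  (forall t : R, 0 <= t -> c <= p (x + t *: y) - t * p y) -> c <= tilt p y x.
Proof.
move=> h; apply: lb_le_inf; first by exists (p (x + 0 *: y) - 0 * p y); exists 0 => /=.
by move=> _ [t /= t0 <-]; exact: h.
Qed.

Lemma tilt_le_id p y x : sublinear p -> tilt p y x <= p x.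
Proof.
by move=> ps; have := tilt_le y x ps (lexx 0); rewrite scale0r addr0 mul0r subr0.
Qed.

Lemma sublinear_tilt p y : sublinear p -> sublinear (tilt p y).
Proof.
move=> ps; have [pD pZ] := ps; split=> [u v|s u].
  rewrite -lerBlDr; apply: le_tilt => t t0; rewrite lerBlDr -lerBlDl.
  apply: le_tilt => r r0; rewrite lerBlDl.
  apply: (le_trans (tilt_le _ _ ps (addr_ge0 t0 r0))).
  have := pD (u + t *: y) (v + r *: y); rewrite addrACA -scalerDl; lra.
rewrite le_eqVlt => /predU1P[<-|s0].
  by rewrite scale0r mul0r -(sublinear0 ps); exact: tilt_le_id.
rewrite -ler_pdivrMl//; apply: le_tilt => t t0; rewrite ler_pdivrMl//.
apply: (le_trans (tilt_le y (s *: u) ps (mulr_ge0 (ltW s0) t0))).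
by rewrite -scalerA -scalerDr sublinearZ ?(ltW s0)// mulrBr mulrA.
Qed.

(** The bound [- p (- x) <= q x] keeps the infimum finite; in a chain, the smaller of two members
    serves for both terms of a sum, whence subadditivity. *)
Lemma sublinear_chain_inf (A : set (E -> R)) p : sublinear p -> A !=set0 ->
  (forall q, A q -> sublinear q /\ forall x, q x <= p x) ->
  (forall q r, A q -> A r -> (forall x, q x <= r x) \/ (forall x, r x <= q x)) ->
  exists m, [/\ sublinear m, forall x, m x <= p x &
                forall q, A q -> forall x, m x <= q x].
Proof.
move=> ps [q0 Aq0] Ap Atot.
pose m x := inf [set q x | q in A].
have mle q x : A q -> m x <= q x.
  move=> Aq; apply: ge_inf; last by exists q.
  exists (- p (- x)) => _ [r Ar <-]; have [rs rp] := Ap _ Ar.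
  by apply: le_trans (sublinear_geN x rs); rewrite lerN2.
have m_ge x (c : R) : (forall q, A q -> c <= q x) -> c <= m x.
  move=> h; apply: lb_le_inf; first by exists (q0 x); exists q0.
  by move=> _ [q Aq <-]; exact: h.
exists m; split=> [|x|q Aq x]; [|exact: le_trans (mle _ _ Aq0) ((Ap _ Aq0).2 x)|
  exact: mle].
split=> [u v|s u].
  rewrite -lerBlDr; apply/m_ge => q Aq; rewrite lerBlDr -lerBlDl.
  apply/m_ge => r Ar; rewrite lerBlDl.
  have [[qD _] _] := Ap _ Aq; have [[rD _] _] := Ap _ Ar.
  have [qr|rq] := Atot _ _ Aq Ar.
    by have := mle _ (u + v) Aq; have := qD u v; have := qr v; lra.
  by have := mle _ (u + v) Ar; have := rD u v; have := rq u; lra.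
rewrite le_eqVlt => /predU1P[<-|s0].
  by rewrite scale0r mul0r -(sublinear0 (Ap _ Aq0).1); exact: mle.
rewrite -ler_pdivrMl//; apply/m_ge => q Aq; rewrite ler_pdivrMl//.
by rewrite -(sublinearZ _ (Ap _ Aq).1 (ltW s0)); exact: mle.
Qed.

Lemma sublinear_minimal p : sublinear p -> exists q, [/\ sublinear q,
  forall x, q x <= p x &
  forall r, sublinear r -> (forall x, r x <= q x) -> r = q].
Proof.
move=> ps; pose P q := sublinear q /\ forall x, q x <= p x.
pose T := {q | P q}.
(* Reversed order: maximal for Zorn's lemma means minimal as a functional. *)
pose rle (q r : T) := `[< forall x, sval r x <= sval q x >].
have [|||A Atot|[q [qs qp]] qmin] := @Zorn T rle.
- by move=> q; apply/asboolP.
- move=> q r s /asboolP rq /asboolP sr; apply/asboolP => x.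
  exact: le_trans (sr x) (rq x).
- move=> [q Pq] [r Pr] /asboolP/= rq /asboolP/= qr.
  have e : q = r by apply/funext => x; apply/eqP; rewrite eq_le qr rq.
  by subst r; congr exist; exact: Prop_irrelevance.
- have [->|A0] := eqVneq A set0; first by exists (exist _ p (conj ps (fun=> lexx _))).
  have [|||m [ms mp mA]] := @sublinear_chain_inf [set sval q | q in A] p ps.
  + by have /set0P[q Aq] := A0; exists (sval q); exists q.
  + by move=> _ [[q [qs qp]] _ <-].
  + move=> _ _ [q Aq <-] [r Ar <-].
    by case: (Atot _ _ Aq Ar) => /asboolP ?; [right|left].
  exists (exist _ m (conj ms mp)) => q Aq; apply/asboolP => x /=.
  by apply: mA; exists q.
exists q; split=> // r rs rq.
have Pr : P r by split=> // x; exact: le_trans (rq x) (qp x).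
have /asboolP : forall x, r x <= q x by [].
by move=> /(qmin (exist _ r Pr))/(congr1 sval).
Qed.

(* A minimal sublinear functional is linear, because tilting it in any
   direction cannot decrease it. *)
Lemma hahn_banach p y : sublinear p ->
  exists f : E -> R^o, [/\ scalar f, forall x, f x <= p x & f y = p y].
Proof.
move=> ps; have ts := sublinear_tilt y ps.
(* Minimizing below [tilt p y] instead of [p] secures the value [p y] at [y]. *)
have [f [fs ft fmin]] := sublinear_minimal ts.
have [fD _] := fs.
have fE u v : f (u + v) = f u + f v.
  apply/eqP; rewrite eq_le fD /=.
  have tf : tilt f v = f.
    by apply: fmin => [|x]; [exact: sublinear_tilt|exact: tilt_le_id].
  by have := tilt_le v u fs ler01; rewrite tf scale1r mul1r; lra.
have fN u : f (- u) = - f u.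
  by have := fE u (- u); rewrite subrr sublinear0//; lra.
have fp x : f x <= p x by apply: le_trans (ft x) _; exact: tilt_le_id.
exists f; split=> //; last first.
  apply/eqP; rewrite eq_le fp /= -lerN2 -fN; apply: (le_trans (ft _)).
  apply: (le_trans (tilt_le _ _ ps ler01)).
  by rewrite scale1r addNr sublinear0// mul1r sub0r.
move=> a u v /=; rewrite fE; congr (_ + _).
have [a0|a0] := leP 0 a; first by rewrite sublinearZ.
rewrite -[in LHS](opprK a) scaleNr fN sublinearZ//; last by rewrite oppr_ge0 ltW.
by rewrite mulNr opprK.
Qed.

End hahn_banach.

(** * Separation of a point from an absorbing convex set *)

Section convex_separation.
Context {R : realType} {E : lmodType R} (C : set E).
Hypothesis C0 : C 0.
Hypothesis Cconv : forall (s : R) x y, 0 <= s -> s <= 1 -> C x -> C y ->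
  C (s *: x + (1 - s) *: y).
Hypothesis Cabs : forall x, exists2 r : R, 0 < r & C (r^-1 *: x).

(** The Minkowski functional of [C]; absorption keeps the set under the infimum nonempty. *)
Definition gauge x : R := inf [set r | 0 < r /\ C (r^-1 *: x)].

Lemma gauge_le (r : R) x : 0 < r -> C (r^-1 *: x) -> gauge x <= r.
Proof. by move=> r0 Cx; apply: ge_inf; [exists 0 => s /= [/ltW]|]. Qed.

Lemma le_gauge (c : R) x : (forall r, 0 < r -> C (r^-1 *: x) -> c <= r) -> c <= gauge x.
Proof.
move=> h; apply: lb_le_inf; last by move=> r [r0 Cr]; exact: h.
by have [r r0 Cr] := Cabs x; exists r.
Qed.

Lemma sublinear_gauge : sublinear gauge.
Proof.
split=> [x y|s x].
  rewrite -lerBlDr; apply: le_gauge => r r0 Cx; rewrite lerBlDr -lerBlDl.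
  apply: le_gauge => s s0 Cy; rewrite lerBlDl.
  have rs0 : 0 < r + s by exact: addr_gt0.
  apply: gauge_le => //.
  have -> : (r + s)^-1 *: (x + y) =
      (r / (r + s)) *: (r^-1 *: x) + (1 - r / (r + s)) *: (s^-1 *: y).
    rewrite scalerDr !scalerA; congr (_ *: _ + _ *: _).
      by field; rewrite !gt_eqF.
    by field; rewrite !gt_eqF.
  apply: Cconv => //; first by rewrite divr_ge0// ltW.
  by rewrite ler_pdivrMr// mul1r lerDl ltW.
rewrite le_eqVlt => /predU1P[<-|s0].
  rewrite scale0r mul0r; apply/ler_addgt0Pr => e e0; rewrite add0r.
  by apply: gauge_le => //; rewrite scaler0.
rewrite -ler_pdivrMl//; apply: le_gauge => r r0 Cx; rewrite ler_pdivrMl//.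
apply: gauge_le; first exact: mulr_gt0.
by rewrite scalerA invfM mulrAC mulVf ?gt_eqF// mul1r.
Qed.

(** A functional below the gauge and equal to it at [e] will do: the gauge is at most 1 on [C] and,
    since [C] is star-shaped about 0, at least 1 off it. *)
Lemma convex_separation e : ~ C e ->
  exists f : E -> R^o, [/\ scalar f, forall x, C x -> f x <= 1 & 1 <= f e].
Proof.
move=> Ce; have [f [fl fp fe]] := hahn_banach e sublinear_gauge.
exists f; split=> // [x Cx|].
  by apply: (le_trans (fp x)); apply: gauge_le; rewrite // invr1 scale1r.
rewrite fe; apply: le_gauge => r r0 Cr; rewrite leNgt; apply/negP => r1.
apply: Ce; have := Cconv (ltW r0) (ltW r1) Cr C0.
by rewrite scalerA divff ?gt_eqF// scale1r scaler0 addr0.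
Qed.

End convex_separation.

Definition linear_subspace {R : realType} {E : lmodType R} (V : set E) : Prop :=
  V 0 /\ forall (a : R) u v, V u -> V v -> V (a *: u + v).

(** * Separation of a point from a closed subspace *)

Section closed_subspace_separation.
Context {R : realType} {E : tvsType R}.

Lemma scalar0 (f : E -> R^o) : scalar f -> f 0 = 0 :> R.
Proof. by move=> fl; have := fl (-1) 0 0; rewrite scaler0 addr0 mulN1r addNr. Qed.

Lemma scalarZ (f : E -> R^o) (a : R) u : scalar f -> f (a *: u) = a * f u :> R.
Proof. by move=> fl; have := fl a u 0; rewrite scalar0// !addr0. Qed.

Lemma scalarB (f : E -> R^o) u v : scalar f -> f (u - v) = f u - f v :> R.
Proof.
by move=> fl; rewrite addrC -scaleN1r fl mulN1r addrC.
Qed.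

Lemma affine_continuous (a : E) (s : R) : continuous (fun x : E => s *: (x - a)).
Proof.
move=> x; apply: (@continuous_comp _ _ _ (fun x : E => (s : R^o, x - a))
    (fun z : R^o * E => z.1 *: z.2)); last exact: scale_continuous.
apply: (@cvg_pair _ _ _ _ (nbhs (s : R^o))); first exact: cvg_cst.
apply: (@continuous_comp _ _ _ (fun x : E => (x, - a)) (fun z : E * E => z.1 + z.2));
  last exact: add_continuous.
by apply: (@cvg_pair _ _ _ _ (nbhs x)); [exact: cvg_id|exact: cvg_cst].
Qed.

(** Scaling by [2 / e] turns the bound 1 into [e / 2], and using both [y - x] and its opposite makes
    it two-sided. *)
Lemma bounded_scalar_continuous (f : E -> R^o) (U : set E) : scalar f ->
  nbhs 0 U -> (forall u, U u -> f u <= 1) -> continuous f.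
Proof.
move=> fl U0 fU x; apply/cvgrPdist_lt => e e0.
have near_scaled (s : R) : \forall y \near x, U (s *: (y - x)).
  by apply: affine_continuous; rewrite subrr scaler0.
near=> y.
have h1 : f ((2 / e) *: (y - x)) <= 1 by apply: fU; near: y; exact: near_scaled.
have h2 : f ((- (2 / e)) *: (y - x)) <= 1 by apply: fU; near: y; exact: near_scaled.
have {}h1 : f y - f x <= e / 2.
  move: h1; rewrite scalarZ// scalarB// -ler_pdivlMl ?divr_gt0//.
  by rewrite invf_div mulr1.
have {}h2 : f x - f y <= e / 2.
  move: h2; rewrite scalarZ// scalarB// mulNr -mulrN opprB.
  by rewrite -ler_pdivlMl ?divr_gt0// invf_div mulr1.
have e2 : e / 2 < e by lra.
by rewrite ltr_norml; apply/andP; split; lra.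
Unshelve. all: by end_near. Qed.

Lemma convex_open_nbhs (e : E) (A : set E) : nbhs e A -> exists B : set E,
  [/\ nbhs e B, B `<=` A &
      forall (s : R) x y, 0 <= s -> s <= 1 -> B x -> B y -> B (s *: x + (1 - s) *: y)].
Proof.
move=> eA; have [BB Bconv [Bopen Bbase]] := @locally_convex R E.
have [B [BBB Be] BA] := Bbase e A eA.
exists B; split=> //; first by apply: open_nbhs_nbhs; split=> //; exact: Bopen.
move=> s x y s0 s1 Bx By.
have sI : Itv.spec (@Itv.num_sem R) (Itv.Real `[0%Z, 1%Z]) s.
  by rewrite /=/Itv.num_sem /= num_real in_itv/= s0 s1.
have := Bconv B (mem_set BBB) x y (Itv.mk sI) (mem_set Bx) (mem_set By).
by rewrite inE.
Qed.

(** For a convex neighbourhood [B] of [e] missing [V], the convex absorbing set [C = V + (e - B)]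
    misses [e]. A linear functional at most 1 on [C] is continuous, because [e - B] is a
    neighbourhood of 0, and vanishes on the subspace [V]. *)
Lemma closed_subspace_separation (V : set E) (e : E) :
  linear_subspace V -> closed V -> ~ V e ->
  exists2 f : dual E, (forall v, V v -> f v = 0) & f e != 0.
Proof.
move=> [V0 VL] Vcl Ve.
have eV : nbhs e (~` V) by apply: open_nbhs_nbhs; split=> //; exact/closed_openC.
have [B [eB BV Bconv]] := convex_open_nbhs eV.
have U0 : nbhs 0 [set u | B (e - u)].
  have := @affine_continuous e (-1) 0.
  rewrite /continuous_at sub0r scaleN1r opprK => /(_ _ eB) eB'.
  by apply: (@filterS _ (nbhs 0) _ _ _ _ eB') => u /=; rewrite scaleN1r opprB.
pose C := [set x | exists2 v, V v & B (e - (x - v))].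
have UC u : B (e - u) -> C u by move=> Bu; exists 0 => //; rewrite subr0.
have C0 : C 0 by apply: UC; exact: nbhs_singleton U0.
have VC v : V v -> C v.
  by move=> Vv; exists v => //; rewrite subrr; exact: nbhs_singleton U0.
have Cconv (s : R) x y : 0 <= s -> s <= 1 -> C x -> C y ->
    C (s *: x + (1 - s) *: y).
  move=> s0 s1 [v Vv Bv] [w Vw Bw]; exists (s *: v + (1 - s) *: w).
    by apply: (VL) => //; rewrite -[_ *: w]addr0; exact: VL.
  have := Bconv _ _ _ s0 s1 Bv Bw; congr B.
  rewrite !(scalerBr _ e) addrACA -opprD -scalerDl [s + _]addrC subrK scale1r.
  by rewrite !scalerBr addrACA -opprD.
have Cabs x : exists2 r : R, 0 < r & C (r^-1 *: x).
  have : (fun t : R^o => t *: x) @ 0 --> (0 : E).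
    rewrite -(scale0r x).
    apply: (@continuous_comp _ _ _ (fun t : R^o => (t, x))
      (fun z : R^o * E => z.1 *: z.2)); last exact: scale_continuous.
    by apply: (@cvg_pair _ _ _ _ (nbhs (0 : R^o))); [exact: cvg_id|exact: cvg_cst].
  move=> /(_ _ U0); rewrite nbhs_filterE => /nbhs_ballP[d /= d0 dU].
  exists (2 / d); first by rewrite divr_gt0.
  apply: UC; apply: dU; rewrite /ball/= sub0r normrN gtr0_norm ?invr_gt0 ?divr_gt0//.
  by rewrite invf_div; lra.
have Ce : ~ C e.
  by move=> [v Vv]; rewrite opprB addrC subrK => /BV.
have [f [fl fC fe]] := convex_separation C0 Cconv Cabs Ce.
have fc : continuous f.
  by apply: (bounded_scalar_continuous fl U0) => u /UC/fC.
have fP : dual_pred f by apply/asboolP.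
exists (Dual fP) => /=; last by rewrite gt_eqF// (lt_le_trans _ fe).
move=> v Vv; apply/eqP; apply: contraT => fv0.
have : f ((2 / f v) *: v) <= 1.
  by apply/fC/VC; rewrite -[_ *: v]addr0; exact: VL.
by rewrite scalarZ// divfK//; lra.
Qed.

End closed_subspace_separation.

(** * Farkas' lemma and interpolation by functionals *)

Section farkas.
Context {R : realType} {E : lmodType R}.

(* Induction on the number of inequalities: if the last one is not redundant,
   a violating point [v0] allows to eliminate it by projecting along [v0]. *)
Lemma farkas (V : set E) (p : nat) (g : 'I_p -> E -> R^o) (h : E -> R^o) :
  linear_subspace V -> (forall i, scalar (g i)) -> scalar h ->
  (forall v, V v -> (forall i, g i v <= 0) -> h v <= 0) ->
  exists2 l : 'I_p -> R, (forall i, 0 <= l i) &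
    forall v, V v -> h v = \sum_i l i * g i v.
Proof.
move=> [V0 VL]; elim: p g h => [|p IH] g h gl hl hg.
  exists (fun=> 0) => // v Vv; rewrite big_ord0.
  have h1 : h v <= 0 by apply: hg => // -[].
  have h2 : h ((-1) *: v + 0) <= 0 by apply: hg => [|[]//]; exact: VL.
  have h0 : h 0 = 0 :> R by have := hl (-1) 0 0; rewrite scaler0 addr0 mulN1r addNr.
  by move: h2; rewrite hl h0 addr0 mulN1r; lra.
pose g' i := g (lift ord0 i).
have [hg'|] := pselect (forall v, V v -> (forall i, g' i v <= 0) -> h v <= 0).
  have [l l0 lh] := IH g' h (fun i => gl _) hl hg'.
  exists (fun i => if unlift ord0 i is Some j then l j else 0) => [i|v Vv].
    by case: unliftP.
  rewrite big_ord_recl unlift_none mul0r add0r lh//.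
  by apply: eq_bigr => i _; rewrite liftK.
move=> /existsNP[v0 /not_implyP[Vv0 /not_implyP[gv0 /negP]]].
rewrite -ltNge => hv0.
set g0 := g ord0; have g0l : scalar g0 by exact: gl.
have g00 : 0 < g0 v0.
  rewrite ltNge; apply/negP => g00; move: hv0; apply/negP; rewrite -leNgt.
  apply: hg => // i; case: (unliftP ord0 i) => [j ->|->//]; exact: gv0.
(* For linear [k], this is [k] composed with the projection along [v0] onto the kernel of [g0]. *)
pose pr (k : E -> R^o) v : R^o := k v - (g0 v / g0 v0) * k v0.
have prE k v : scalar k -> pr k v = k ((- (g0 v / g0 v0)) *: v0 + v).
  by move=> kl; rewrite kl mulNr addrC.
have prl k : scalar k -> scalar (pr k).
  move=> kl a u v; rewrite /pr kl g0l; rewrite /GRing.scale/=; ring.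
have [|||l l0 lh] := IH (fun i => pr (g' i)) (pr h).
- by move=> i; apply/prl/gl.
- exact: prl.
- move=> v Vv gv; rewrite prE//; apply: hg; first exact: VL.
  move=> i; case: (unliftP ord0 i) => [j ->|->]; first by rewrite -prE//; exact: gv.
  by rewrite -/g0 g0l mulNr divfK ?gt_eqF// addNr.
(* The weight of [g0] balances both sides at [v0]; it is nonnegative since [h v0 > 0] and every
   [g' j v0 <= 0]. *)
exists (fun i => if unlift ord0 i is Some j then l j else
    (h v0 - \sum_j l j * g' j v0) / g0 v0) => [i|v Vv].
  case: unliftP => // _; rewrite divr_ge0 ?(ltW g00)// subr_ge0.
  rewrite (le_trans _ (ltW hv0))// sumr_le0// => j _.
  by rewrite mulr_ge0_le0.
rewrite big_ord_recl unlift_none.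
under [X in _ + X]eq_bigr do rewrite liftK.
have := lh v Vv; rewrite (eq_bigr (fun i =>
  l i * g' i v - (g0 v / g0 v0) * (l i * g' i v0))); last first.
  by move=> i _; rewrite /pr mulrBr mulrCA.
rewrite sumrB -mulr_sumr /pr => /eqP; rewrite subr_eq => /eqP ->.
by rewrite -/g0; ring.
Qed.

End farkas.

(* Each step of the induction restricts [K] to the functionals vanishing at one
   of the given points, which enlarges the annihilator by that point. *)
Lemma annihilator_interpolation {R : realType} {E : tvsType R}
    (K : set (dual E)) (psi : dual E) (ws : seq E) : linear_subspace K ->
  (forall e, (forall f, K f -> f e = 0) -> psi e = 0) ->
  exists2 f, K f & {in ws, f =1 psi}.
Proof.
elim: ws K psi => [|w ws IH] K psi KS psiK; first by exists 0 => //; case: KS.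
have [K0 KL] := KS.
have [Kw|] := pselect (forall f, K f -> f w = 0).
  have [f Kf fpsi] := IH K psi KS psiK.
  exists f => // x; rewrite inE => /predU1P[->|]; last exact: fpsi.
  by rewrite Kw// psiK.
move=> /existsNP[f0 /not_implyP[Kf0 /eqP f0w]].
pose c : R := psi w / f0 w.
have [||f [Kf fw] fpsi] := IH [set f | K f /\ f w = 0] (psi - c *: f0).
- split=> [|a f g [Kf fw] [Kg gw]]; first by split.
  by split; [exact: KL|rewrite /= !fctE fw gw scaler0 addr0].
- move=> e eK.
  (* Any [f] in [K] takes at this point the value of [f - (f w / f0 w) f0] at [e], and that
     combination lies in [K] and vanishes at [w]. *)
  have : psi ((- (f0 e / f0 w)) *: w + e) = 0.
    apply: psiK => f Kf; rewrite dual_scalar.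
    have := eK ((- (f w / f0 w)) *: f0 + f).
    have : K ((- (f w / f0 w)) *: f0 + f) by exact: KL.
    rewrite /= !fctE /GRing.scale/= mulNr divfK// addNr => Kf' /(_ (conj Kf' erefl)).
    by move=> <-; field.
  rewrite dual_scalar /= !fctE /GRing.scale/= /c => <-; field.
  exact: f0w.
exists (c *: f0 + f); first exact: KL.
move=> x; rewrite inE /= !fctE => /predU1P[->|xws].
  by rewrite fw addr0 /c /GRing.scale/= divfK.
by rewrite fpsi//= !fctE addrC subrK.
Qed.

(** * Normals to an intersection of generalized polyhedral sets *)

Section polyhedral_normal_cones.
Context {R : realType} {E : tvsType R}.

Lemma dual_sumE (p : nat) (l : 'I_p -> R) (g : 'I_p -> dual E) (x : E) :
  (\sum_i l i *: g i) x = \sum_i l i * g i x :> R.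
Proof. by rewrite (big_morph (fun f : dual E => f x : R) (id1 := 0) (op1 := +%R)). Qed.

(** Only constraints active at [e] restrict small steps within the affine subspace: an inactive one
    has slack, which a short enough step does not use up. *)
Lemma gpoly_convex_tangent (C : set E) (e : E) : gpoly_convex_set C -> C e ->
  exists (V : set E) (p : nat) (g : 'I_p -> dual E),
    [/\ linear_subspace V, closed V,
        forall w, C w -> V (w - e) /\ forall i, g i (w - e) <= 0 &
        forall v, V v -> (forall i, g i v <= 0) ->
          \forall t \near (0 : R)^'+, C (e + t *: v)].
Proof.
move=> [L [p [zs [alpha [[a [V [Vsub LE]]] Lcl CE]]]]] Ce.
have VS : linear_subspace V.
  have [/set_mem V0 VL] := Vsub; split=> // r u v Vu Vv.
  by apply/set_mem/VL; exact/mem_set.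
have Le : L e by move: Ce; rewrite CE => -[].
have [v0 Vv0 eE] : exists2 v0, V v0 & a + v0 = e by move: Le; rewrite LE => -[v]; exists v.
have [V0 VL] := VS.
have LV w : L w <-> V (w - e).
  rewrite LE -eE; split=> [[v Vv <-]|Vw].
    rewrite opprD addrACA subrr add0r addrC -scaleN1r; exact: VL.
  exists (w - a); last by rewrite addrC subrK.
  have := VL 1 _ _ Vw Vv0; rewrite scale1r opprD addrA subrK.
  by [].
(* Inactive constraints become 0, so that the index type stays ['I_p]. *)
exists V, p, (fun i => if zs i e == alpha i then zs i else 0); split=> //.
- have -> : V = (fun v => 1 *: (v - (- e))) @^-1` L.
    by apply/seteqP; split=> v /=; rewrite scale1r opprK LV addrK.
  by apply: closed_comp Lcl => x _; exact: affine_continuous.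
- move=> w; rewrite CE => -[/LV Vw wa]; split=> // i.
  case: ifPn => [/eqP ea|//].
  by rewrite scalarB ?ea ?subr_le0 ?wa//; exact: dual_scalar.
move=> v Vv gv; rewrite CE.
have LVv (t : R) : L (e + t *: v).
  by apply/LV; rewrite addrC addrA addNr add0r -[_ *: v]addr0; exact: VL.
suff H : \forall t \near (0 : R)^'+, forall i, zs i (e + t *: v) <= alpha i.
  by apply: filterS H => t.
apply: filter_forall => i.
have zsE (t : R) : zs i (e + t *: v) = t * zs i v + zs i e.
  by rewrite addrC dual_scalar.
have ea : zs i e <= alpha i by move: Ce; rewrite CE => -[_]; exact.
have := gv i; have [{}ea|ne _] := eqVneq (zs i e) (alpha i).
  move=> zv; near=> t.
  have t0 : 0 <= t by near: t; exact: nbhs_right_ge.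
  by rewrite zsE -ea gerDr mulr_ge0_le0.
have d0 : 0 < alpha i - zs i e by rewrite subr_gt0 lt_neqAle ne.
have k0 : 0 < 1 + `|zs i v : R| by rewrite ltr_pwDl.
near=> t; rewrite zsE -lerBrDr.
have t0 : 0 <= t by near: t; exact: nbhs_right_ge.
apply: (@le_trans _ _ (t * (1 + `|zs i v : R|))).
  by rewrite ler_wpM2l// (le_trans (ler_norm _))// lerDr.
by rewrite -ler_pdivlMr//; near: t; apply: nbhs_right_le; rewrite divr_gt0.
Unshelve. all: by end_near. Qed.

(* The polyhedral parts are handled exactly by Farkas; only the sum of the
   annihilators of the two direction spaces may fail to be weak* closed. *)
Lemma normal_cone_setI_interpolation (C1 C2 : set E) (e : E) (h : dual E)
    (ws : seq E) : gpoly_convex_set C1 -> gpoly_convex_set C2 ->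
  normal_cone e (C1 `&` C2) h ->
  exists h1 h2 : dual E, [/\ normal_cone e C1 h1, normal_cone e C2 h2 &
    {in ws, h1 + h2 =1 h}].
Proof.
move=> P1 P2 [[C1e C2e] hC].
have [V1 [p1 [g1 [S1 cl1 sub1 tan1]]]] := gpoly_convex_tangent P1 C1e.
have [V2 [p2 [g2 [S2 cl2 sub2 tan2]]]] := gpoly_convex_tangent P2 C2e.
pose g (k : 'I_(p1 + p2)) : dual E :=
  match fintype.split k with inl i => g1 i | inr j => g2 j end.
have gl i : g (lshift p2 i) = g1 i by rewrite /g (unsplitK (inl i)).
have gr j : g (rshift p1 j) = g2 j by rewrite /g (unsplitK (inr j)).
have SI : linear_subspace (V1 `&` V2).
  have [[? V1L] [? V2L]] := (S1, S2).
  by split=> // a u v [? ?] [? ?]; split; [exact: V1L|exact: V2L].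
have [|||l l0 lh] := @farkas _ _ _ _ g h SI.
- by move=> i; exact: dual_scalar.
- exact: dual_scalar.
- move=> v [V1v V2v] gv.
  (* Such a direction is feasible for both sets at small steps [t > 0], where normality bounds
     [h]. *)
  have : \forall t \near (0 : R)^'+, 0 < t /\ (C1 `&` C2) (e + t *: v).
    near=> t; split; first by near: t; exact: nbhs_right_gt.
    split; near: t; [apply: tan1 => // i|apply: tan2 => // i].
      by rewrite -gl.
    by rewrite -gr.
  move=> /filter_ex[t [t0 /hC]]; rewrite addrAC subrr add0r scalarZ; last exact: dual_scalar.
  by rewrite pmulr_rle0.
pose G1 : dual E := \sum_i l (lshift p2 i) *: g1 i.
pose G2 : dual E := \sum_j l (rshift p1 j) *: g2 j.
pose ann (V : set E) := [set f : dual E | forall v, V v -> f v = 0].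
have annL V (a : R) f f' : ann V f -> ann V f' -> ann V (a *: f + f').
  by move=> fV fV' v Vv; rewrite /= !fctE fV// fV'// scaler0 addr0.
have [||f [f1 V1f1 [f2 V2f2 <-]] fh] := @annihilator_interpolation R E
    [set f1 + f2 | f1 in ann V1 & f2 in ann V2] (h - (G1 + G2)) ws.
- split; first by exists 0 => //; exists 0 => //; rewrite addr0.
  move=> a _ _ [f1 ? [f2 ? <-]] [f1' ? [f2' ? <-]].
  exists (a *: f1 + f1'); first exact: annL.
  exists (a *: f2 + f2'); first exact: annL.
  by rewrite scalerDr addrACA.
- move=> v vK.
  (* A point outside [V1] would be detected by some functional in [ann V1]. *)
  have V1v : V1 v.
    apply: contrapT => /(closed_subspace_separation S1 cl1)[f Vf /eqP]; apply.
    by apply: vK; exists f => //; exists 0 => //; rewrite addr0.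
  have V2v : V2 v.
    apply: contrapT => /(closed_subspace_separation S2 cl2)[f Vf /eqP]; apply.
    by apply: vK; exists 0 => //; exists f => //; rewrite add0r.
  rewrite /= !fctE lh// !dual_sumE big_split_ord/=.
  under eq_bigr do rewrite gl.
  under [X in _ + X - _]eq_bigr do rewrite gr.
  by rewrite subrr.
exists (G1 + f1), (G2 + f2); split.
- split=> // w /sub1[Vw gw]; rewrite /= !fctE V1f1// addr0 dual_sumE.
  by rewrite sumr_le0// => i _; rewrite mulr_ge0_le0.
- split=> // w /sub2[Vw gw]; rewrite /= !fctE V2f2// addr0 dual_sumE.
  by rewrite sumr_le0// => i _; rewrite mulr_ge0_le0.
move=> w /fh; rewrite addrACA /= !fctE => ->.
by rewrite addrC subrK.
Unshelve. all: by end_near. Qed.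

End polyhedral_normal_cones.

(** * Closures for the weak* topology *)

Section weak_star_closure.
Context {R : realType} {E : tvsType R}.

Lemma dual_eval_continuous (w : E) : continuous (fun f : dual E => f w : R^o).
Proof.
move=> f; have := @continuous_comp (dual E) {ptws E -> R^o} R^o
  (@dual_fun R E : dual E -> {ptws E -> R^o}) (fun g : {ptws E -> R^o} => g w) f.
apply; first exact: (@initial_continuous _ {ptws E -> R^o} (@dual_fun R E) f).
exact: (@proj_continuous E (fun=> R^o) w).
Qed.

Lemma closure_dual_le (A : set (dual E)) (h : dual E) (w : E) (c : R) :
  (forall f, A f -> f w <= c) -> closure A h -> h w <= c.
Proof.
move=> Ac; have Acl : closed [set f : dual E | f w <= c].
  apply: (@closed_comp _ _ (fun f : dual E => f w : R^o) [set x : R^o | x <= c]).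
    by move=> f _; exact: dual_eval_continuous.
  exact: closed_le.
by move=> /(closureS Ac); rewrite -((closure_id _).1 Acl).
Qed.

(** The sets of members of [A] agreeing with [h] on a finite list, one for each list, form a filter
    base converging pointwise to [h]. *)
Lemma closure_dual_agree (A : set (dual E)) (h : dual E) :
  (forall ws : seq E, exists2 f, A f & {in ws, f =1 h}) -> closure A h.
Proof.
move=> Ah B hB.
pose F := filter_from [set: seq E] (fun ws => [set f | A f /\ {in ws, f =1 h}]).
have FF : Filter F.
  apply: filter_from_filter; first by exists [::].
  move=> s1 s2 _ _; exists (s1 ++ s2) => // f [Af fh].
  by split; split=> // w ws; apply: fh; rewrite mem_cat ws ?orbT.
have Fh : (@dual_fun R E @ F : set_system {ptws E -> R^o}) --> (@dual_fun R E h : {ptws E -> R^o}).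
  apply/pointwise_cvgP => w U Uh; exists [:: w] => // f [_ fh] /=.
  by rewrite /= fh ?mem_head//; exact: nbhs_singleton.
move: hB => [_ [[U Uop <-] Uh UB]].
have [ws _ wsU] : (@dual_fun R E @ F) U by apply: Fh; exact: open_nbhs_nbhs.
have [f Af fh] := Ah ws.
by exists f; split=> //; apply: UB; exact: wsU.
Qed.

End weak_star_closure.

(** * Normals to an epigraph cut by a cylinder *)

Section epigraph_normals.
Context {R : realType}.

Lemma dual_realE (k : dual R^o) (s : R) : k s = s * k 1 :> R.
Proof. by rewrite -(scalarZ s (1 : R^o) (dual_scalar k)) [_ *: _]mulr1. Qed.

(** Lifts [D] to the space of the epigraph, so that the two can be intersected. *)
Lemma gpoly_convex_cylinder (E : tvsType R) (D : set E) : gpoly_convex_set D ->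
  gpoly_convex_set [set p : E * R^o | D p.1].
Proof.
move=> [L [p [zs [alpha [[a [V [[V0 VL] LE]]] Lcl DE]]]]].
exists [set p | L p.1], p, (fun i => dual_pair (zs i, 0)), alpha; split.
- exists (a, 0), [set p | V p.1]; split.
    split; first by apply/mem_set => /=; exact: set_mem V0.
    move=> r u v /set_mem/= Vu /set_mem/= Vv; apply/mem_set => /=.
    by apply/set_mem/VL; exact/mem_set.
  apply/seteqP; split=> [[w s]|_ [[v s] /= Vv <-]] /=; rewrite LE /=.
    by move=> [v Vv <-]; exists (v, s) => //; congr pair; rewrite /= add0r.
  by exists v.
- by apply: (closed_comp _ Lcl) => w _; exact: cvg_fst.
- by rewrite DE; apply/seteqP; split=> -[w s] /= [Lw wa]; split=> // i;
    have := wa i; rewrite /= addr0.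
Qed.

(** The cylinder contains vertical lines, so its normals have zero last component; interpolating
    also at [(0, 1)] then makes that of the epigraph normal exactly [k]. *)
Lemma normal_cone_epi_interpolation (E : tvsType R) (f : E -> \bar R)
    (D : set E) (z : E) (r : R^o) (h : dual E) (k : dual R^o) (ws : seq E) :
  gpoly_convex_fun f -> gpoly_convex_set D ->
  normal_cone (z, r) (epi f `&` [set p | D p.1]) (dual_pair (h, k)) ->
  exists a b : dual E, [/\ normal_cone (z, r) (epi f) (dual_pair (a, k)),
    normal_cone z D b & {in ws, a + b =1 h}].
Proof.
move=> fP DP hN.
have [h1 [h2 [h1N h2N h12]]] := @normal_cone_setI_interpolation _ (E * R^o)%type _ _ _ _
  ((0 : E, 1 : R^o) :: [seq (w, 0 : R^o) | w <- ws]) fP (gpoly_convex_cylinder DP) hN.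
have [g _ gK] := @dual_pair_bij _ E R^o.
move: (g h1) (gK h1) h1N h12 => [a k1] /= <- h1N.
move: (g h2) (gK h2) h2N => [b k2] /= <- h2N h12.
have k2s (s : R) : k2 s <= 0.
  have := h2N.2 (z, r + s) h2N.1.
  by rewrite /= subrr scalar0 ?add0r; [rewrite addrC addKr|exact: dual_scalar].
have k20 : k2 1 = 0.
  apply/eqP; rewrite eq_le k2s /=.
  by have := k2s (-1); rewrite dual_realE mulN1r oppr_le0.
have k1E : k1 = k.
  apply/val_inj/funext => s /=; rewrite (dual_realE k1) (dual_realE k); congr (_ * _).
  have := h12 (0, 1) (mem_head _ _); rewrite /= !fctE /=.
  by rewrite k20 !(scalar0 (dual_scalar _)) !add0r addr0.
exists a, b; split.
- by rewrite -k1E.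
- split=> [|w Dw]; first exact: h2N.1.
  have := h2N.2 (w, r) Dw; rewrite /= subrr.
  by rewrite (scalar0 (dual_scalar _)) addr0.
move=> w wws; have := h12 (w, 0).
rewrite inE map_f// orbT => /(_ isT) /=; rewrite !fctE /=.
by rewrite !(scalar0 (dual_scalar _)) !addr0.
Qed.

End epigraph_normals.

(** * Subdifferentials of the optimal value function *)

Section optimal_value_subdifferential.
Context {R : realType}.

(* [k = 0] gives the singular subdifferential and [k = - id] the ordinary one,
   so that both formulas are instances of a single one. *)
Definition gen_subdiff (E : tvsType R) (k : dual R^o) (f : E -> \bar R) (z : E) :
    set (dual E) :=
  [set zs | f z \is a fin_num /\
    normal_cone (z, fine (f z) : R^o) (epi f) (dual_pair (zs, k))].

Lemma dual_oppr_subproof : dual_pred (-%R : R^o -> R^o).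
Proof.
apply/asboolP; split; first by move=> a u v; rewrite opprD -scalerN.
exact: opp_continuous.
Qed.

Definition dual_oppr : dual R^o := Dual dual_oppr_subproof.

Lemma subdiff_gen (E : tvsType R) (f : E -> \bar R) (z : E) :
  subdiff f z = gen_subdiff dual_oppr f z.
Proof.
apply/seteqP; split=> zs [fz zsf]; split=> //.
  split=> [|[w s] /= fw]; first by rewrite /epi /= fineK.
  have := le_trans (zsf w) (leeB fw (lexx _)).
  by rewrite -[f z in X in X -> _]fineK// -EFinB lee_fin /= subr_le0.
move=> w; have /= := fun s => zsf.2 (w, s); rewrite /epi /=.
rewrite -(fineK fz) /=; case: (f w) => [s||] fw.
- by rewrite -EFinB lee_fin; have := fw s (lexx _); lra.
- by rewrite addye// leey.
(* Over a point of value [-oo] the epigraph is a full vertical line; this height turns normality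
   into [1 <= 0]. *)
- by exfalso; have := fw (fine (f z) + (zs (w - z) : R) - 1)%R (leNye _); lra.
Qed.

Lemma pr_dual0P (E F : tvsType R) (W : set (dual (E * F)%type)) (zs : dual E) :
  pr_dual0 W zs <-> W (dual_pair (zs, 0)).
Proof.
split=> [[[a b] [/= Wab [_ /= b0]] <-]|Wz]; first by rewrite -b0.
by exists (zs, 0).
Qed.

Context {X Y : tvsType R}.

(** The part of [epi phi] over [gph G] projects into the epigraph of the optimal value and fills it
    up to an arbitrarily small rise, the infimum being possibly unattained. *)
Lemma gen_subdiff_opt_valueP (phi : X * Y -> \bar R) (G : X -> set Y) (x : X)
    (k : dual R^o) (zs : dual X) : opt_value phi G x \is a fin_num ->
  gen_subdiff k (opt_value phi G) x zs <->
  forall u v (s : R), G u v -> (phi (u, v) <= s%:E)%E ->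
    zs (u - x) + k (s - fine (opt_value phi G x)) <= 0.
Proof.
move=> mux; split=> [[_ [_ zsN]] u v s Guv phis|zsN].
  apply: (zsN (u, s)); rewrite /epi /=; apply: le_trans phis.
  by apply: ereal_inf_lbound; exists v.
split=> //; split=> [|[u s] /= mus]; first by rewrite /epi /= fineK.
apply/ler_addgt0Pr => e e0; rewrite add0r.
(* Raising the height by [d] changes the value of [k] by at most [e]. *)
pose d := e / (1 + `|k 1 : R|).
have k0 : 0 < 1 + `|k 1 : R| by rewrite ltr_pwDl.
have d0 : 0 < d by rewrite divr_gt0.
have [_ [v Guv <-] phis] : exists2 t, [set phi (u, v) | v in G u] t & (t < (s + d)%:E)%E.
  by apply: ereal_inf_lt; apply: le_lt_trans mus _; rewrite lte_fin ltrDl.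
have := zsN u v (s + d) Guv (ltW phis).
have -> : s + d - fine (opt_value phi G x) = (s - fine (opt_value phi G x)) + d by ring.
have -> : k ((s - fine (opt_value phi G x)) + d) =
    d * k 1 + k (s - fine (opt_value phi G x)) :> R.
  by rewrite addrC -[in LHS](mulr1 d); exact: (dual_scalar k d 1).
have : - (d * k 1) <= e.
  rewrite -mulrN; apply: (@le_trans _ _ (d * (1 + `|k 1 : R|))).
    by rewrite ler_wpM2l ?(ltW d0)// -normrN (le_trans (ler_norm _))// lerDr.
  by rewrite /d divfK// gt_eqF.
lra.
Qed.

Lemma gen_subdiff_opt_value (phi : X * Y -> \bar R) (G : X -> set Y) (x : X)
    (y : Y) (k : dual R^o) :
  gpoly_convex_fun phi -> gpoly_convex_map G ->
  opt_value phi G x \is a fin_num -> solution_map phi G x y ->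
  gen_subdiff k (opt_value phi G) x =
    pr_dual0 (closure
      (dual_add (gen_subdiff k phi (x, y)) (normal_cone (x, y) (gph G)))).
Proof.
move=> phiP GP mux [Gxy muE]; have phix : phi (x, y) \is a fin_num by rewrite -muE.
have dualE (zs : dual X) (u : X) (v : Y) : dual_pair (zs, 0 : dual Y) ((u, v) - (x, y)) = zs (u - x).
  by rewrite /= addr0.
apply/seteqP; split=> zs.
  move=> /(gen_subdiff_opt_valueP _ _ mux); rewrite muE => zsN; apply/pr_dual0P.
  apply: closure_dual_agree => ws.
  have [|a [b [aN bN ab]]] := @normal_cone_epi_interpolation _ _ phi (gph G)
    (x, y) (fine (phi (x, y))) (dual_pair (zs, 0)) k ws phiP GP.
    split; first by split; [rewrite /epi /= fineK|].
    by move=> [[u v] s] [/= phis Guv]; rewrite addr0; exact: (zsN u v s).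
  by exists (a + b) => //; exists a => //; exists b.
(* Conversely, the two normal inequalities add up at a fixed point, and the resulting bound on an
   evaluation survives weak* closure. *)
move=> /pr_dual0P zsW; apply/gen_subdiff_opt_valueP => // u v s Guv phis.
rewrite muE -(dualE zs u v) -lerBrDr sub0r.
apply: (closure_dual_le _ zsW) => _ [a [_ [_ aN]] [b [_ bN] <-]].
have := aN ((u, v), s) phis; have := bN (u, v) Guv.
rewrite /= !fctE; lra.
Qed.

End optimal_value_subdifferential.

Theorem theorem4p1 (R : realType) (X Y : tvsType R)
    (hausX : hausdorff_space X) (hausY : hausdorff_space Y)
    (phi : X * Y -> \bar R) (G : X -> set Y)
    (phi_proper : proper_fun phi)
    (phi_gpc : gpoly_convex_fun phi)
    (G_gpc : gpoly_convex_map G)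
    (x : X) (mu_fin : opt_value phi G x \is a fin_num)
    (y : Y) (My : solution_map phi G x y) :
  subdiff (opt_value phi G) x =
    pr_dual0 (closure
      (dual_add (subdiff phi (x, y)) (normal_cone (x, y) (gph G))))
  /\
  singular_subdiff (opt_value phi G) x =
    pr_dual0 (closure
      (dual_add (singular_subdiff phi (x, y)) (normal_cone (x, y) (gph G)))).
Proof.
(* The singular subdifferential is [gen_subdiff] at [k = 0] by mere unfolding. *)
split; last exact: gen_subdiff_opt_value.
by rewrite !subdiff_gen; exact: gen_subdiff_opt_value.
Qed.
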